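(* Let $X$ be a simplicial complex, let $\alpha>0$ be a real number, and let $(\mathbf f,\alpha)$ be an almost integral $1$-cocycle on $X$. Then there exists a linear circle valued map $f\colon X\to \mathbb S^1=\mathbb R/\alpha\mathbb Z$ whose associated $1$-cocycle is $\mathbf f$. That is, for every oriented edge $(x,y)$ of $X$ and every continuous lift $\hat f$ to $\mathbb R$ of the restriction of $f$ to that edge, one has $\hat f(y)-\hat f(x)=\mathbf f(x,y)$.
   Context: $X$ denotes both a simplicial complex and its geometric realization. $\mathcal X_0$ is its set of vertices, and $\mathcal X_1\subset \mathcal X_0\times\mathcal X_0$ is the set of oriented edges, i.e. of ordered pairs $(x,y)$ of distinct vertices spanning a $1$-simplex. A $1$-cocycle is a map $\mathbf f\colon\mathcal X_1\to\mathbb R$ such that $\mathbf f(x,y)=-\mathbf f(y,x)$ for every $(x,y)\in\mathcal X_1$, and $\mathbf f(x,y)+\mathbf f(y,z)+\mathbf f(z,x)=0$ whenever $x,y,z$ are the vertices of a $2$-simplex. It extends additively to integral $1$-chains. An almost integral $1$-cocycle is a pair $(\mathbf f,\alpha)$ where $\alpha>0$ is real and $\mathbf f$ is a $1$-cocycle whose values on integral (simplicial) $1$-cycles are integer multiples of $\alpha$. Let $p\colon\mathbb R\to\mathbb R/\alpha\mathbb Z$ be the quotient map. For a continuous map $f\colon X\to\mathbb R/\alpha\mathbb Z$ and a simplex $\sigma$, a lift of $f|_\sigma$ is a continuous map $\hat f\colon\sigma\to\mathbb R$ with $p\circ\hat f=f|_\sigma$. The map $f$ is called linear if for every simplex $\sigma$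 at least one lift of $f|_\sigma$ (and then every lift) is linear on $\sigma$, i.e. affine in barycentric coordinates. The $1$-cocycle associated with a linear map $f$ assigns to each oriented edge $(x,y)$ the number $\hat f(y)-\hat f(x)$, where $\hat f$ is any lift of the restriction of $f$ to the edge. *)

(* Defs.v *)
From HB Require Import structures.
From mathcomp Require Import all_boot all_order all_algebra finmap.
From mathcomp Require Import all_classical all_reals all_analysis.
From mathcomp Require Import freeg.
Import Order.TTheory GRing.Theory Num.Theory.
Import numFieldNormedType.Exports.

Set Implicit Arguments.
Unset Strict Implicit.
Unset Printing Implicit Defensive.

Local Open Scope fset_scope.
Local Open Scope classical_set_scope.
Local Open Scope quotient_scope.
Local Open Scope ring_scope.

(* Abstract simplicial complexes, of arbitrary cardinality and dimension,
   whose set of vertices is the whole type V. *)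
Record simplicialComplex (V : choiceType) := SimplicialComplex {
  simplex : set {fset V} ;
  simplex_neq0 : forall s, simplex s -> s != fset0 ;
  simplex_vertex : forall v, simplex [fset v] ;
  simplex_face : forall s t,
    simplex s -> (t `<=` s)%fset -> t != fset0 -> simplex t
}.

Section Realization.
Variables (R : realType) (V : choiceType) (X : simplicialComplex V).

(* x : V -> R is a family of barycentric coordinates, supported on s. *)
Definition barycentric (s : {fset V}) (x : V -> R) : Prop :=
  [/\ forall v, v \notin s -> x v = 0,
      forall v, 0 <= x v &
      \sum_(v <- s) x v = 1].

Record realization := Realization {
  coord :> V -> R ;
  coordP : exists s, simplex X s /\ barycentric s coord
}.

HB.instance Definition _ := gen_eqMixin realization.
HB.instance Definition _ := gen_choiceMixin realization.

Definition closed_simplex (s : {fset V}) : set realization :=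
  [set x | barycentric s x].

(* The weak topology: U is open iff its trace on every closed simplex |s| is
   open in the Euclidean topology of |s|, given by the sup distance between
   barycentric coordinates. *)
Definition realization_open (U : set realization) : Prop :=
  forall s, simplex X s -> forall x, closed_simplex s x -> U x ->
    exists2 e : R, 0 < e &
      forall y, closed_simplex s y -> (forall v, `|x v - y v| < e) -> U y.

Lemma realization_openT : realization_open setT.
Proof. by move=> s _ x _ _; exists 1. Qed.

Lemma realization_openI : setI_closed realization_open.
Proof.
move=> A B oA oB s Xs x sx [Ax Bx].
have [e e0 Ae] := oA s Xs x sx Ax; have [d d0 Bd] := oB s Xs x sx Bx.
exists (Num.min e d) => [|y sy xy]; first by rewrite lt_min e0.
by split; [apply: Ae | apply: Bd] => // v;
  apply: lt_le_trans (xy v) _; rewrite ge_min lexx ?orbT.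
Qed.

Lemma realization_open_bigU (I : Type) (F : I -> set realization) :
  (forall i, realization_open (F i)) -> realization_open (\bigcup_i F i).
Proof.
move=> oF s Xs x sx [i _ Fix]; have [e e0 Fe] := oF i s Xs x sx Fix.
by exists e => // y sy xy; exists i => //; apply: Fe.
Qed.

HB.instance Definition _ := isOpenTopological.Build realization
  realization_openT realization_openI realization_open_bigU.

Lemma vertex_subproof (v : V) :
  exists s, simplex X s /\ barycentric s (fun w => (w == v)%:R : R).
Proof.
exists [fset v]; split; first exact: simplex_vertex.
split=> [w|w|]; last by rewrite big_seq_fset1 eqxx.
- by rewrite inE => /negbTE ->.
- exact: ler0n.
Qed.

Definition vertex (v : V) : realization := Realization (vertex_subproof v).

End Realization.

Section Circle.
Variables (R : realType) (a : R).

Definition circle_rel (x y : R) : bool :=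
  `[< exists k : int, x - y = k%:~R * a >].

Lemma circle_rel_equiv : equiv_class_of circle_rel.
Proof.
split=> [x|x y|y x z].
- by apply/asboolP; exists 0; rewrite subrr mul0r.
- by apply/asboolP/asboolP => -[k xy]; exists (- k);
    rewrite -opprB xy mulrNz mulNr.
- move=> /asboolP[k xy] /asboolP[l yz]; apply/asboolP; exists (k + l).
  by rewrite intrD mulrDl -xy -yz addrA subrK.
Qed.

Canonical circle_equiv := EquivRelPack circle_rel_equiv.

(* The circle R / aZ, with the quotient topology. *)
Definition circle : Type := quotient_topology {eq_quot circle_equiv}.

HB.instance Definition _ := Topological.on circle.
HB.instance Definition _ := Quotient.on circle.

Definition circle_proj (x : R) : circle := \pi_circle x.

End Circle.

Section Cocycles.
Variables (R : realType) (V : choiceType) (X : simplicialComplex V).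

Record edge := Edge {
  edge_pair : V * V ;
  edgeP : (edge_pair.1 != edge_pair.2) &&
          `[< simplex X [fset edge_pair.1; edge_pair.2] >]
}.

HB.instance Definition _ := [isSub for edge_pair].
HB.instance Definition _ := [Choice of edge by <:].

Definition src (e : edge) : V := (val e).1.
Definition tgt (e : edge) : V := (val e).2.

(* Consecutive oriented edges e1, e2, e3 closing up have pairwise distinct
   vertices, so the simplex in the second condition is 2-dimensional. *)
Definition cocycle (c : edge -> R) : Prop :=
  (forall e e' : edge, src e' = tgt e -> tgt e' = src e -> c e = - c e') /\
  (forall e1 e2 e3 : edge,
     tgt e1 = src e2 -> tgt e2 = src e3 -> tgt e3 = src e1 ->
     simplex X [fset src e1; src e2; src e3] -> c e1 + c e2 + c e3 = 0).

(* Integral 1-chains are represented in the free abelian group on the oriented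
   edges. The relation identifying an edge with the opposite of the reversed
   edge is not imposed: it is respected by both the boundary and cocycles. *)
Definition chain1 : Type := {freeg edge}.

Definition boundary (z : chain1) : {freeg V} :=
  fglift (fun e => << tgt e >> - << src e >> : {freeg V}) z.

(* The additive extension of c to chains; zmodule R is R as a Z-module. *)
Definition eval_chain (c : edge -> R) (z : chain1) : R :=
  fglift (c : edge -> zmodule R) z.

Definition almost_integral_cocycle (c : edge -> R) (a : R) : Prop :=
  [/\ 0 < a, cocycle c &
      forall z : chain1, boundary z = 0 ->
        exists k : int, eval_chain c z = k%:~R * a].

End Cocycles.

Section LinearMaps.
Variables (R : realType) (V : choiceType) (X : simplicialComplex V) (a : R).
Implicit Types (f : realization R X -> circle a) (g : realization R X -> R).

(* g restricts to a continuous lift of f on the closed simplex |s|; the values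
   of g outside |s| are irrelevant. *)
Definition is_lift f (s : {fset V}) g : Prop :=
  {within closed_simplex s, continuous g} /\
  (forall x, closed_simplex s x -> circle_proj a (g x) = f x).

Definition affine_on (s : {fset V}) g : Prop :=
  forall x, closed_simplex s x -> g x = \sum_(v <- s) x v * g (vertex R X v).

Definition linear_map f : Prop :=
  continuous f /\
  forall s, simplex X s -> exists2 g, is_lift f s g & affine_on s g.

(* Quantifying over all lifts is not vacuous for a linear map: every simplex,
   in particular every edge, has a lift. *)
Definition associated_cocycle f (c : edge X -> R) : Prop :=
  forall (e : edge X) g, is_lift f [fset src e; tgt e] g ->
    g (vertex R X (tgt e)) - g (vertex R X (src e)) = c e.

End LinearMaps.

(* Main.v *)
Require Import Defs.
From mathcomp Require Import all_boot all_order all_algebra finmap.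
From mathcomp Require Import all_classical all_reals all_analysis.
From mathcomp Require Import freeg ring lra.
Import Order.TTheory GRing.Theory Num.Theory.
Import numFieldNormedType.Exports.

(* Choose a chain [z v] from a base vertex of its component to each vertex [v].
   The potential [phi v = f(z v)] satisfies [phi y - phi x = f(x, y)] modulo
   [a], because [z x + (x, y) - z y] is a cycle.  On a closed simplex with a
   chosen vertex [u], the affine map with value [phi u + f(u, v)] at each vertex
   [v] is independent of [u] modulo [a], so these maps glue to a linear map to
   the circle.  Two lifts on an edge differ by a continuous map from a
   connected set to [a Z], that is, by a constant. *)

Set Implicit Arguments.
Unset Strict Implicit.
Unset Printing Implicit Defensive.

Local Open Scope classical_set_scope.
Local Open Scope ring_scope.

(** * Integral chains and the potential modulo [a] *)

Section Chains.
Variables (R : realType) (V : choiceType) (X : simplicialComplex V).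
Implicit Types (z : chain1 X) (c : edge X -> R) (e : edge X).

Lemma boundaryB z z' : boundary (z - z') = boundary z - boundary z'.
Proof. exact: lift_is_additive. Qed.

Lemma boundary0 : boundary (0 : chain1 X) = 0.
Proof. by rewrite -[X in boundary X](subrr 0) boundaryB subrr. Qed.

Lemma boundaryD z z' : boundary (z + z') = boundary z + boundary z'.
Proof.
by rewrite -[z' in LHS]opprK boundaryB -[- z']sub0r boundaryB boundary0 sub0r
  opprK.
Qed.

Lemma boundary_edge e : boundary << e >> = << tgt e >> - << src e >>.
Proof. by rewrite /boundary liftU scale1r. Qed.

Lemma eval_chainB c z z' :
  eval_chain c (z - z') = eval_chain c z - eval_chain c z'.
Proof. exact: (@lift_is_additive _ _ _ (c : edge X -> zmodule R) z z'). Qed.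

Lemma eval_chain0 c : eval_chain c 0 = 0.
Proof. by rewrite -[X in eval_chain c X](subrr 0) eval_chainB subrr. Qed.

Lemma eval_chainD c z z' :
  eval_chain c (z + z') = eval_chain c z + eval_chain c z'.
Proof.
by rewrite -[z' in LHS]opprK eval_chainB -[- z']sub0r eval_chainB eval_chain0
  sub0r opprK.
Qed.

Lemma eval_chain_edge c e : eval_chain c << e >> = c e.
Proof. by rewrite /eval_chain liftU scale1r. Qed.

(** This stands for lying in the same component: chains replace edge paths, so that concatenation is
    addition and reversal is negation. *)
Definition homologous (v w : V) : Prop :=
  exists z : chain1 X, boundary z = << v >> - << w >>.

Lemma homologous_refl v : homologous v v.
Proof. by exists 0; rewrite boundary0 subrr. Qed.

Lemma homologous_sym v w : homologous v w -> homologous w v.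
Proof.
by case=> z zb; exists (0 - z); rewrite boundaryB boundary0 zb sub0r opprB.
Qed.

Lemma homologous_trans v w u :
  homologous v w -> homologous w u -> homologous v u.
Proof.
by case=> z zb [z' zb']; exists (z + z'); rewrite boundaryD zb zb' addrA subrK.
Qed.

Lemma homologous_edge e : homologous (tgt e) (src e).
Proof. by exists << e >>; exact: boundary_edge. Qed.

Lemma homologous_base :
  exists b : V -> V,
    (forall v, homologous v (b v)) /\ forall e, b (src e) = b (tgt e).
Proof.
exists (fun v => xget v (homologous v)); split=> [v|e].
  by apply: (@xgetPex _ v (homologous v)); exists v; exact: homologous_refl.
have -> : homologous (tgt e) = homologous (src e).
  apply/funext => w; apply/propext; split; apply: homologous_trans.
    exact/homologous_sym/homologous_edge.
  exact: homologous_edge.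
(* The classes are now equal but the default values of [xget] are not, so the class has to be shown
   nonempty. *)
rewrite /xget; case: pselect => // -[]; exists (src e).
exact/asboolP/homologous_refl.
Qed.

Lemma almost_integral_potential c (a : R) : almost_integral_cocycle c a ->
  exists phi : V -> R, forall e, exists k : int,
    phi (src e) + c e - phi (tgt e) = k%:~R * a.
Proof.
move=> [_ _ cint]; have [b [hb eb]] := homologous_base.
have [z zb] := choice hb; exists (fun v => eval_chain c (z v)) => e.
have [|k ck] := cint (z (src e) + << e >> - z (tgt e)); last first.
  by exists k; rewrite -ck eval_chainB eval_chainD eval_chain_edge.
(* The chain closes up because both ends of [e] have the same base vertex. *)
by rewrite boundaryB boundaryD boundary_edge !zb eb
  [<< src e >> - _ + _]addrC addrA subrK subrr.
Qed.

End Chains.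

(** * The cocycle as a function of two vertices of a simplex *)

Section CocycleOnPairs.
Variables (R : realType) (V : choiceType) (X : simplicialComplex V).
Variable c : edge X -> R.

(* The value is [0] when [(u, v)] is not an edge, in particular when [u = v]. *)
Definition cocycle_pair (u v : V) : R := oapp c 0 (insub (u, v)).

Lemma cocycle_pair_edge e : cocycle_pair (src e) (tgt e) = c e.
Proof. by rewrite /cocycle_pair /src /tgt -surjective_pairing valK. Qed.

Lemma cocycle_pair_refl u : cocycle_pair u u = 0.
Proof. by rewrite /cocycle_pair insubN //= eqxx. Qed.

Lemma simplex_edge s u v : simplex X s -> u \in s -> v \in s -> u != v ->
  exists2 e : edge X, src e = u & tgt e = v.
Proof.
move=> Xs us vs uv.
have uvP : ((u, v).1 != (u, v).2) &&
    `[< simplex X [fset (u, v).1; (u, v).2]%fset >].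
  rewrite uv /=; apply/asboolP/(simplex_face Xs).
    by apply/fsubsetP => w; rewrite !inE => /orP[] /eqP ->.
  by apply/fset0Pn; exists u; rewrite !inE eqxx.
by exists (Edge uvP).
Qed.

Lemma cocycle_pair_sym s u v : cocycle c -> simplex X s ->
  u \in s -> v \in s -> cocycle_pair v u = - cocycle_pair u v.
Proof.
move=> [cN _] Xs us vs; have [->|uv] := eqVneq u v.
  by rewrite cocycle_pair_refl oppr0.
have [e eu ev] := simplex_edge Xs us vs uv.
have [|e' e'v e'u] := simplex_edge Xs vs us; first by rewrite eq_sym.
rewrite -{1}e'v -{1}e'u -eu -ev !cocycle_pair_edge.
by apply: cN; rewrite ?ev ?eu.
Qed.

(** Three distinct vertices span a face of [s], where the cocycle condition applies. Allowing
    coincidences lets [v] range over all vertices of [s] in barycentric sums. *)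
Lemma cocycle_pair_trans s u v w : cocycle c -> simplex X s ->
  u \in s -> v \in s -> w \in s ->
  cocycle_pair u v + cocycle_pair v w = cocycle_pair u w.
Proof.
move=> cc Xs us vs ws; have [_ cT] := cc.
have [->|uv] := eqVneq u v; first by rewrite cocycle_pair_refl add0r.
have [->|vw] := eqVneq v w; first by rewrite cocycle_pair_refl addr0.
have [<-|uw] := eqVneq u w.
  by rewrite (cocycle_pair_sym cc Xs us vs) subrr cocycle_pair_refl.
(* The right-hand side is reversed so that the three edges run cyclically. *)
rewrite [RHS](cocycle_pair_sym cc Xs ws us); apply/eqP.
rewrite -subr_eq0 opprK; apply/eqP.
have [e1 e1u e1v] := simplex_edge Xs us vs uv.
have [e2 e2v e2w] := simplex_edge Xs vs ws vw.
have [|e3 e3w e3u] := simplex_edge Xs ws us; first by rewrite eq_sym.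
rewrite -{1}e1u -{1}e1v -{1}e2v -{1}e2w -e3w -e3u !cocycle_pair_edge.
apply: cT; rewrite ?e1u ?e1v ?e2v ?e2w ?e3w ?e3u //.
apply: (simplex_face Xs).
  by apply/fsubsetP => y; rewrite !inE => /orP[/orP[]|] /eqP ->.
by apply/fset0Pn; exists u; rewrite !inE eqxx.
Qed.

End CocycleOnPairs.

(** * Barycentric coordinates, the weak topology and segments *)

Section RealizationTopology.
Variables (R : realType) (V : choiceType) (X : simplicialComplex V).
Implicit Types (s : {fset V}) (x y : realization R X).

Lemma openE_realization (U : set (realization R X)) :
  open U = realization_open U.
Proof. by []. Qed.

Lemma coord_continuous (v : V) :
  continuous (fun x : realization R X => x v : R).
Proof.
apply/continuousP => A oA; rewrite openE_realization => s Xs x sx Ax.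
have /nbhs_ballP[e /= e0 eA] := open_nbhs_nbhs (conj oA Ax).
by exists e => // y _ xy; apply: eA; exact: xy.
Qed.

(** Both sums equal the sum over the union of [s] and [t], since the added coordinates vanish. This
    compares formulas on two simplices at a common point. *)
Lemma barycentric_sum_eq s (t : {fset V}) (x : V -> R) (F : V -> R) :
  barycentric s x -> barycentric t x ->
  \sum_(v <- s) x v * F v = \sum_(v <- t) x v * F v.
Proof.
move=> [x0s _ _] [x0t _ _].
rewrite (big_fset_incl _ (fsubsetUl s t)).
  rewrite (big_fset_incl _ (fsubsetUr s t)) // => v _ /x0t ->.
  by rewrite mul0r.
by move=> v _ /x0s ->; rewrite mul0r.
Qed.

Lemma barycentric_neq0 s (x : V -> R) : barycentric s x -> exists v, x v != 0.
Proof.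
move=> [_ _ x1]; apply: contrapT => /forallNP x0.
move/eqP: x1; rewrite big1 ?(eq_sym 0) ?oner_eq0 // => v _.
by apply/eqP/negPn/negP; exact: x0.
Qed.

Lemma barycentric_mem s (x : V -> R) v :
  barycentric s x -> x v != 0 -> v \in s.
Proof. by move=> [x0 _ _]; apply: contraNT => /x0 ->. Qed.

Lemma barycentric_le1 s (x : V -> R) v : barycentric s x -> x v <= 1.
Proof.
move=> [x0 xge0 <-]; have [vs|/x0 ->] := boolP (v \in s); last exact: sumr_ge0.
by rewrite (big_fsetD1 v vs) /= lerDl sumr_ge0.
Qed.

Lemma barycentric_convex s (x y : V -> R) (t : R) : 0 <= t <= 1 ->
  barycentric s x -> barycentric s y ->
  barycentric s (fun v => (1 - t) * x v + t * y v).
Proof.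
move=> /andP[t0 t1] [x0 xge0 x1] [y0 yge0 y1]; split.
- by move=> v vs; rewrite x0 // y0 // !mulr0 addr0.
- by move=> v; rewrite addr_ge0 // mulr_ge0 // subr_ge0.
- by rewrite big_split /= -!mulr_sumr x1 y1 !mulr1 subrK.
Qed.

Lemma closed_simplex_vertex s v : v \in s -> closed_simplex s (vertex R X v).
Proof.
move=> vs; split=> [w|w|] /=.
- by case: (eqVneq w v) => // ->; rewrite vs.
- exact: ler0n.
- rewrite (big_fsetD1 v vs) /= eqxx big_seq big1 ?addr0 // => w.
  by rewrite !inE => /andP[/negbTE -> _].
Qed.

(** Clamping the parameter to the unit interval lets a segment be parametrized by the whole real
    line. *)
Lemma clamp_itv (t : R) : 0 <= Num.min 1 (Num.max 0 t) <= 1.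
Proof. by rewrite le_min ler01 le_max lexx ge_min lexx. Qed.

Lemma clamp_lip (t u : R) :
  `|Num.min 1 (Num.max 0 t) - Num.min 1 (Num.max 0 u)| <= `|t - u|.
Proof.
have cl (v : R) : [\/ v <= 0 /\ Num.min 1 (Num.max 0 v) = 0,
    0 <= v /\ v <= 1 /\ Num.min 1 (Num.max 0 v) = v |
    1 <= v /\ Num.min 1 (Num.max 0 v) = 1].
  have [v0|/ltW v0] := leP v 0; first by constructor 1; rewrite (min_r ler01).
  by have [v1|/ltW v1] := leP v 1; [constructor 2|constructor 3].
have := ler_norm (t - u); have := ler_norm (u - t); rewrite distrC => tu ut.
rewrite ler_norml; apply/andP; split;
  by case: (cl t) => [[t0 ->]|[t0 [t1 ->]]|[t0 ->]];
     case: (cl u) => [[u0 ->]|[u0 [u1 ->]]|[u0 ->]]; lra.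
Qed.

Lemma segment_connected_in_simplex s x y : simplex X s ->
  closed_simplex s x -> closed_simplex s y ->
  exists A : set (realization R X),
    [/\ A `<=` closed_simplex s, connected A, A x & A y].
Proof.
move=> Xs sx sy; pose cl (t : R) : R := Num.min 1 (Num.max 0 t).
have segP (t : R) : barycentric s (fun v => (1 - cl t) * x v + cl t * y v).
  exact: barycentric_convex (clamp_itv t) sx sy.
pose seg (t : R) : realization R X :=
  Realization (ex_intro _ s (conj Xs (segP t))).
(* Points with equal coordinates differ only in their proof component. *)
have seg_eq t (z : realization R X) :
    Defs.coord z = Defs.coord (seg t) -> z = seg t.
  by case: z => z zP /= zE; subst z; congr Realization; exact: Prop_irrelevance.
have cseg : continuous seg.
  apply/continuousP => U; rewrite openE_realization => oU.
  rewrite openE => t /= Ut.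
  have [e e0 Ue] := oU s Xs (seg t) (segP t) Ut.
  (* The same radius works for the parameter: each coordinate of [seg] is 1-Lipschitz, because
     clamping is and [y v - x v] has absolute value at most 1. *)
  apply/nbhs_ballP; exists e => //= u tu; apply: Ue; first exact: segP.
  move=> v /=; apply: le_lt_trans tu.
  have -> : (1 - cl t) * x v + cl t * y v - ((1 - cl u) * x v + cl u * y v)
    = (cl t - cl u) * (y v - x v) by ring.
  rewrite normrM -[leRHS]mulr1; apply: ler_pM => //; first exact: clamp_lip.
  case: (sx) (sy) => _ /(_ v) ? _ [_ /(_ v) ? _].
  move: (barycentric_le1 v sx) (barycentric_le1 v sy) => ? ?.
  by rewrite ler_norml; lra.
exists (range seg); split.
- by move=> _ [t _ <-]; exact: segP.
- apply: connected_continuous_connected; last exact: continuous_subspaceT.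
  by apply/connected_intervalP => ? ? ? ? ? ?.
- exists 0 => //; apply/esym/seg_eq/funext => v /=.
  by rewrite /cl maxxx min_r // subr0 mul1r mul0r addr0.
- exists 1 => //; apply/esym/seg_eq/funext => v /=.
  by rewrite /cl (max_r ler01) minxx subrr mul0r mul1r add0r.
Qed.

End RealizationTopology.

(** * Uniqueness of lifts up to a constant *)

Section Lifts.
Variables (R : realType) (V : choiceType) (X : simplicialComplex V) (a : R).
Implicit Types (f : realization R X -> circle a) (g h : realization R X -> R).

Lemma circle_projP (x y : R) :
  circle_proj a x = circle_proj a y <-> exists k : int, x - y = k%:~R * a.
Proof.
by split=> [/eqmodP/asboolP//|xy]; apply/eqmodP/asboolP.
Qed.

Lemma circle_proj_continuous : continuous (circle_proj a).
Proof. exact: pi_continuous. Qed.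

(** A connected set of reals is an interval. If it contained two distinct multiples of [a], it would
    contain the point [a / 2] above the smaller one, which is not a multiple. *)
Lemma connected_lattice (A : set R) (x y : R) : 0 < a -> connected A ->
  (forall z, A z -> exists k : int, z = k%:~R * a) -> A x -> A y -> x = y.
Proof.
move=> a0 /connected_intervalP cA Az Ax Ay.
wlog xy : x y Ax Ay / x < y.
  by move=> H; case: (ltgtP x y) => // [|?]; [|symmetry]; exact: H.
have [k xk] := Az _ Ax; have [l yl] := Az _ Ay.
have kl : k + 1 <= l.
  by move: xy; rewrite xk yl ltr_pM2r // ltr_int lezD1.
have klR : k%:~R + 1 <= l%:~R :> R by rewrite -[1]/(1%:~R) -intrD ler_int.
have /Az[m mE] : A ((k%:~R + 1 / 2) * a).
  by apply: (cA x y) => //; rewrite xk yl !ler_pM2r //; apply/andP; split; lra.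
have {}mE : k%:~R + 1 / 2 = m%:~R :> R by apply: (mulIf (lt0r_neq0 a0)).
have : k%:~R < m%:~R :> R by lra.
have : m%:~R < (k + 1)%:~R :> R by rewrite intrD; lra.
by rewrite !ltr_int ltzD1 => /le_lt_trans H /H; rewrite ltxx.
Qed.

Lemma lifts_differ_by_constant f s g h x y : 0 < a -> simplex X s ->
  is_lift f s g -> is_lift f s h -> closed_simplex s x -> closed_simplex s y ->
  g y - g x = h y - h x.
Proof.
move=> a0 Xs [gc gf] [hc hf] sx sy.
have [A [As cA Ax Ay]] := segment_connected_in_simplex Xs sx sy.
suff /eqP : g x - h x = g y - h y.
  by move=> /eqP gh; rewrite -[g y](subrK (h y)) -gh; ring.
(* Continuity of the lifts is only known within the closed simplex, so it is restricted to the
   segment [A]. *)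
apply: (@connected_lattice ((fun z => g z - h z) @` A)) => //.
- apply: connected_continuous_connected => // z.
  by apply: (@continuousB _ _ (subspace A) g h);
    [exact: (continuous_subspaceW As gc)|exact: (continuous_subspaceW As hc)].
- move=> _ [z Az <-]; apply/circle_projP.
  by rewrite gf ?hf //; exact: As.
- by exists x.
- by exists y.
Qed.

End Lifts.

(** * Affine lifts on simplices and their gluing *)

Section AffineLift.
Variables (R : realType) (V : choiceType) (X : simplicialComplex V).
Variables (c : edge X -> R) (a : R) (phi : V -> R).
Hypothesis cc : cocycle c.
Hypothesis phiP : forall e, exists k : int,
  phi (src e) + c e - phi (tgt e) = k%:~R * a.
Implicit Types (s t : {fset V}) (x : realization R X).

(** With [phi u] outside the sum, the formula is continuous on the whole realization. It is affine
    on the closed simplex because the coordinates there sum to 1. *)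
Definition affine_lift s (u : V) x : R :=
  phi u + \sum_(v <- s) x v * cocycle_pair c u v.

Lemma affine_lift_continuous s u : continuous (affine_lift s u).
Proof.
move=> x.
have A : {for x, continuous (fun _ : realization R X => phi u : R)}.
  exact: cst_continuous.
have B : {for x, continuous (fun y : realization R X =>
    \sum_(v <- s) y v * cocycle_pair c u v : R)}.
  apply: cvg_big => [||v _]; [exact: add_continuous|exact: nbhs_filter|].
  apply: (@continuousM _ _ (fun y : realization R X => y v)).
    exact: coord_continuous.
  exact: cst_continuous.
exact: (continuousD A B).
Qed.

Lemma affine_lift_vertex s u v : v \in s ->
  affine_lift s u (vertex R X v) = phi u + cocycle_pair c u v.
Proof.
move=> vs; rewrite /affine_lift (big_fsetD1 v vs) /= eqxx mul1r big_seq big1.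
  by rewrite addr0.
by move=> w; rewrite !inE => /andP[/negbTE -> _]; rewrite mul0r.
Qed.

Lemma affine_lift_affine s u : affine_on s (affine_lift s u).
Proof.
move=> x [_ _ x1]; rewrite big_seq.
under eq_bigr => v vs do rewrite affine_lift_vertex // mulrDr.
by rewrite -big_seq big_split /= -mulr_suml x1 mul1r.
Qed.

(** By additivity of [c] along [u], [w], [v], the two lifts differ on the simplex by the constant
    [phi u + c(u, w) - phi w], a multiple of [a]. *)
Lemma affine_lift_proj_vertex s u w x : simplex X s -> u \in s -> w \in s ->
  closed_simplex s x ->
  circle_proj a (affine_lift s u x) = circle_proj a (affine_lift s w x).
Proof.
move=> Xs us ws [_ _ x1].
have -> : affine_lift s u x = phi u + cocycle_pair c u w - phi w
    + affine_lift s w x.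
  rewrite /affine_lift; have -> : \sum_(v <- s) x v * cocycle_pair c u v =
      cocycle_pair c u w + \sum_(v <- s) x v * cocycle_pair c w v.
    rewrite -[cocycle_pair c u w]mul1r -x1 mulr_suml -big_split /=.
    rewrite !big_seq; apply: eq_bigr => v vs.
    by rewrite -mulrDr (cocycle_pair_trans cc Xs).
  by ring.
(* The case [u = w] is separate, since [phiP] speaks only of edges. *)
apply/circle_projP; rewrite addrK; have [->|uw] := eqVneq u w.
  by exists 0; rewrite cocycle_pair_refl addr0 subrr mul0r.
by have [e <- <-] := simplex_edge Xs us ws uw; rewrite cocycle_pair_edge.
Qed.

Lemma affine_lift_glue : exists f : realization R X -> circle a,
  forall s u x, simplex X s -> u \in s -> closed_simplex s x ->
    circle_proj a (affine_lift s u x) = f x.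
Proof.
suff /choice[f fP] : forall x, exists p : circle a,
    forall s u, simplex X s -> u \in s -> closed_simplex s x ->
      circle_proj a (affine_lift s u x) = p.
  by exists f => s u x Xs us sx; exact: fP.
move=> x; have [t [Xt tx]] := coordP x; have [w xw] := barycentric_neq0 tx.
(* Since [x w] is nonzero, [w] belongs to every simplex carrying [x]. One first moves the base
   vertex from [u] to [w] within [s], then replaces [s] by [t]. *)
exists (circle_proj a (affine_lift t w x)) => s u Xs us sx.
rewrite (affine_lift_proj_vertex Xs us (barycentric_mem sx xw) sx).
by rewrite /affine_lift (barycentric_sum_eq _ sx tx).
Qed.

End AffineLift.

(** * Continuity tested on simplices, and the resulting circle valued map *)

Lemma continuous_on_simplices (R : realType) (V : choiceType)
    (X : simplicialComplex V) (T : topologicalType)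
    (f : realization R X -> T) :
  (forall s, simplex X s -> exists2 g : realization R X -> T, continuous g &
     forall x, closed_simplex s x -> g x = f x) ->
  continuous f.
Proof.
move=> fs; apply/continuousP => U oU; rewrite openE_realization => s Xs x sx Ux.
have [g /continuousP gc gf] := fs s Xs.
have := gc _ oU; rewrite openE_realization => gU.
(* Weak openness is tested on one closed simplex at a time, and there [f] may be replaced by [g]. *)
have [e e0 eU] := gU s Xs x sx (eq_ind_r U Ux (gf x sx)).
by exists e => // y sy xy; rewrite /preimage /= -gf //; exact: eU.
Qed.

Theorem mainTheorem1 (R : realType) (V : choiceType) (X : simplicialComplex V)
    (c : edge X -> R) (a : R) (hc : almost_integral_cocycle c a) :
  exists f : realization R X -> circle a,
    linear_map f /\ associated_cocycle f c.
Proof.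
have [a0 cc _] := hc; have [phi phiP] := almost_integral_potential hc.
have [f fP] := affine_lift_glue cc phiP.
have lift_f s u : simplex X s -> u \in s -> is_lift f s (affine_lift c phi s u).
  move=> Xs us; split; last by move=> x; exact: fP.
  exact/continuous_subspaceT/affine_lift_continuous.
exists f; split; first split.
- apply: continuous_on_simplices => s Xs.
  have /fset0Pn[u us] := simplex_neq0 Xs.
  exists (fun x => circle_proj a (affine_lift c phi s u x)); last first.
    by move=> x; exact: fP.
  move=> x; apply: continuous_comp; first exact: affine_lift_continuous.
  exact: circle_proj_continuous.
- move=> s Xs; have /fset0Pn[u us] := simplex_neq0 Xs.
  exists (affine_lift c phi s u); first exact: lift_f.
  exact: affine_lift_affine.
- move=> e g gl; have /andP[_ /asboolP Xe] := edgeP e.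
  have es : src e \in [fset src e; tgt e]%fset by rewrite !inE eqxx.
  have et : tgt e \in [fset src e; tgt e]%fset by rewrite !inE eqxx orbT.
  (* The arbitrary lift [g] is compared with the affine lift based at [src e], whose values at the
     source and target are [phi (src e)] and [phi (src e) + c e]. *)
  rewrite (lifts_differ_by_constant a0 Xe gl (lift_f _ _ Xe es)) //.
  + rewrite !affine_lift_vertex // cocycle_pair_refl cocycle_pair_edge.
    by ring.
  + exact: closed_simplex_vertex.
  + exact: closed_simplex_vertex.
Qed.
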